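(* Let $(E,\leqslant,\mathfrak{c})$ be an enriched qoset. Then $(\mathfrak{c}^{\uparrow})^{\circ}=(\mathfrak{c}^{\circ})^{\uparrow}$. Assume moreover that one of the following conditions is satisfied: (1) every principal order-ideal $\downarrow x$ of $E$ is finite, or (2) $\mathfrak{c}$ is finitary. Then $\mathfrak{c}^{\uparrow}$ is finitary and $$\mathfrak{c}^{\uparrow}(A)=\bigcup_{F}\big(\mathfrak{c}(F)\cap F^{\uparrow}\big)$$ for all $A\subseteq E$, where the union runs over the finite subsets $F\subseteq A$. Moreover (still under (1) or (2)), if $\mathfrak{c}$ separates points, then $$\mathfrak{c}^{\uparrow}(A)=\bigcup_{F}F^{\vee}$$ for all $A\subseteq E$, where the union runs over the finite subsets $F\subseteq A$ with a $\mathfrak{c}$-sup.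
   Context: A qoset $(E,\leqslant)$ is a set with a reflexive transitive relation. $\downarrow A=\{x:\exists a\in A,\,x\leqslant a\}$, $\uparrow A=\{x:\exists a\in A,\,a\leqslant x\}$, $\downarrow x=\downarrow\{x\}$. $F^{\uparrow}$ is the set of upper bounds of $F$, and $F^{\vee}$ is the set of all suprema (least upper bounds) of $F$ in $E$. A preclosure operator on $E$ is a map $\mathfrak{c}:2^E\to2^E$ with $A\subseteq\mathfrak{c}(A)\subseteq\mathfrak{c}(B)$ whenever $A\subseteq B$; $A$ is $\mathfrak{c}$-closed if $\mathfrak{c}(A)=A$. An enriched qoset $(E,\leqslant,\mathfrak{c})$ is a qoset with a preclosure operator such that $\downarrow\mathfrak{c}(A)=\mathfrak{c}(A)$ for all $A\subseteq E$. For any preclosure operator $\mathfrak{c}$, define $\mathfrak{c}^{\circ}(A)=\bigcup\{\mathfrak{c}(F):F\subseteq A\text{ finite}\}$ and $\mathfrak{c}^{\uparrow}(A)=\bigcap_{B\subseteq E}\big(\mathfrak{c}(A\cap B)\cup\uparrow(A\setminus B)\big)$; these are preclosure operators. $\mathfrak{c}$ is finitary if $\mathfrak{c}=\mathfrak{c}^{\circ}$. $\mathfrak{c}$ separates points if, whenever $x\not\leqslant y$, there is a $\mathfrak{c}$-closed $V$ with $y\in V$ and $x\notin V$. A subset $F$ has a $\mathfrak{c}$-sup if $F$ has a supremum in $E$ that belongs to $\mathfrak{c}(F)$. *)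

(* Defs.v *)
From HB Require Import structures.
From mathcomp Require Import all_boot all_order.
From mathcomp Require Import boolp classical_sets functions cardinality.

Set Implicit Arguments.
Unset Strict Implicit.
Unset Printing Implicit Defensive.

Import Order.TTheory.
Local Open Scope order_scope.
Local Open Scope classical_set_scope.

(* The library's [ubound], [down], [isLub] and [supremums] require
   antisymmetry ([porderType]); the notions below are their analogues for
   quasi-orders ([preorderType]), where a set may have several suprema. *)
Section Qoset.
Context {d : Order.disp_t} {E : preorderType d}.
Implicit Types (A F : set E) (x y : E).

Definition downset A : set E := [set x | exists2 a, A a & x <= a].

Definition upset A : set E := [set x | exists2 a, A a & a <= x].

Definition upper_bounds F : set E := [set u | forall a, F a -> a <= u].

Definition suprema F : set E :=
  [set s | upper_bounds F s /\ forall u, upper_bounds F u -> s <= u].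

End Qoset.

Section Preclosure.
Context {d : Order.disp_t} {E : preorderType d}.
Implicit Types (c : set E -> set E) (A B F V : set E).

Definition preclosure c :=
  forall A B, A `<=` B -> A `<=` c A /\ c A `<=` c B.

Definition enriched c :=
  preclosure c /\ forall A, downset (c A) = c A.

Definition closed_for c A := c A = A.

Definition finitary_part c : set E -> set E :=
  fun A => \bigcup_(F in [set F | finite_set F /\ F `<=` A]) c F.

Definition up_part c : set E -> set E :=
  fun A => \bigcap_(B in [set: set E]) (c (A `&` B) `|` upset (A `\` B)).

Definition finitary c := c = finitary_part c.

Definition separates_points c :=
  forall x y : E, ~~ (x <= y) ->
    exists V, [/\ closed_for c V, V y & ~ V x].

Definition has_csup c F := exists2 s, suprema F s & c F s.

Lemma preclosure_finitary_part c : preclosure c -> preclosure (finitary_part c).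
Proof.
move=> hc A B AB; split=> [a Aa|x [F [finF FA] cFx]].
- exists [set a]; first by split=> // _ ->.
  by have [+ _] := hc [set a] [set a] (@subset_refl _ _); apply.
- by exists F => //; split=> // y /FA /AB.
Qed.

Lemma preclosure_up_part c : preclosure c -> preclosure (up_part c).
Proof.
move=> hc A B AB; split=> [a Aa C _|x xA C _].
- have [Ca|nCa] := pselect (C a); last by right; exists a.
  by left; have [+ _] := hc (A `&` C) _ (@subset_refl _ _); apply.
- have [cx|[a [Aa nCa] ax]] := xA C I.
    by left; have [_] := hc _ _ (@setSI _ C _ _ AB); apply.
  by right; exists a => //; split=> //; apply: AB.
Qed.

End Preclosure.

(* Main.v *)
Require Import Defs.
From HB Require Import structures.
From mathcomp Require Import all_boot all_order.
From mathcomp Require Import boolp classical_sets functions cardinality.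

Local Open Scope order_scope.
Local Open Scope classical_set_scope.

(** The operator [up_part c] has a pointwise description: [x] lies in
[up_part c A] iff [x] lies in [c] of the part of [A] below [x]
([up_partE]), because the set of elements below [x] is the most demanding
choice of [B] in the intersection defining [up_part].

Both [finitary_part (up_part c)] and [up_part (finitary_part c)] then describe
the points [x] lying in [c F] for some finite [F] contained in [A] and bounded
above by [x]: intersecting a finite subset of [A] with the elements below [x]
keeps it finite, so it does not matter in which order one cuts down to finite
subsets and to elements below [x].  This common value is exactly the union of
the sets [c F `&` upper_bounds F] ([up_finitary_partE]).

Under either extra hypothesis [c] and [finitary_part c] agree on the sets
[A `&` downset [set x]], so the two operators have the same [up_part]; this
yields finitariness and the first formula.  When [c] separates points, an upper
bound of [F] in [c F] is a least one ([csup_suprema]), since closed sets are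
down-closed and so a closed set containing an upper bound of [F] contains all
of [c F].  Conversely [c F], being down-closed, contains all the suprema of [F]
as soon as it contains one, since any two of them lie below each other. *)

Section UpPart.
Context {d : Order.disp_t} {E : preorderType d}.
Implicit Types (c : set E -> set E) (A F V : set E) (x y : E).

Lemma downset1E x y : downset [set x] y = (y <= x) :> Prop.
Proof. by apply/propext; split=> [[_ ->]|yx] //; exists x. Qed.

Lemma preclosure_mono c A F : preclosure c -> A `<=` F -> c A `<=` c F.
Proof. by move=> hc /hc[]. Qed.

(** Taking [B] to be the set of elements below [x] empties the second term of
the union at [x].  Conversely, if [x] is above no element of [A `\` B], then
[B] contains the part of [A] below [x] and monotonicity applies. *)
Lemma up_partE c A :
  preclosure c -> up_part c A = [set x | c (A `&` downset [set x]) x].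
Proof.
move=> hc; apply/seteqP; split=> x /=.
  move=> /(_ (downset [set x]) I)[//|[a [_ nax] ax]].
  by case: nax; rewrite downset1E.
move=> cx B _; have [?|nBx] := pselect (upset (A `\` B) x); [by right|left].
apply: (preclosure_mono _ _ _ hc _ _ cx) => a [Aa]; rewrite downset1E => ax.
by split=> //; apply: contrapT => nBa; apply: nBx; exists a.
Qed.

Lemma up_finitary_partE c A : preclosure c ->
  up_part (finitary_part c) A =
  \bigcup_(F in [set F | finite_set F /\ F `<=` A]) (c F `&` upper_bounds F).
Proof.
move=> hc; rewrite up_partE; last exact: preclosure_finitary_part.
apply/seteqP; split=> x /= [F [finF FA]].
  move=> cFx; exists F; first by split=> // a /FA[].
  by split=> // a /FA[_]; rewrite downset1E.
move=> [cFx Fx]; exists F => //; split=> // a Fa.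
by split; [exact: FA|rewrite downset1E; exact: Fx].
Qed.

Lemma finitary_up_partE c A : preclosure c ->
  finitary_part (up_part c) A =
  \bigcup_(F in [set F | finite_set F /\ F `<=` A]) (c F `&` upper_bounds F).
Proof.
move=> hc; apply/seteqP; split=> x [F [finF FA]].
  rewrite up_partE //= => cx; exists (F `&` downset [set x]).
    by split; [exact: finite_setIl|move=> a [/FA]].
  by split=> // a [_]; rewrite downset1E.
move=> [cFx Fx]; exists F => //; rewrite up_partE //=.
apply: (preclosure_mono _ _ _ hc _ _ cFx) => a Fa.
by split=> //; rewrite downset1E; exact: Fx.
Qed.

Lemma finitary_part_finite c F :
  preclosure c -> finite_set F -> finitary_part c F = c F.
Proof.
move=> hc finF; apply/seteqP; split=> x; last by move=> cFx; exists F => //; split.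
by move=> [G [_ GF]]; apply: preclosure_mono.
Qed.

Lemma up_part_finitary_part c :
  preclosure c ->
  (forall x, finite_set (downset [set x])) \/ finitary c ->
  up_part (finitary_part c) = up_part c.
Proof.
move=> hc [fin_down|<-//]; apply/funext => A.
rewrite !up_partE //; last exact: preclosure_finitary_part.
apply/eq_set => x; rewrite finitary_part_finite //.
exact: finite_setIr (fin_down x).
Qed.

Lemma closed_down c V x y :
  enriched c -> closed_for c V -> V y -> x <= y -> V x.
Proof. by move=> [_ hd] cV Vy xy; rewrite -cV -hd cV; exists y. Qed.

(** If [x] were not below some upper bound [u] of [F], a closed set containing
[u] but not [x] would contain [F], hence [c F], hence [x]. *)
Lemma csup_suprema c F x : enriched c -> separates_points c ->
  c F x -> upper_bounds F x -> suprema F x.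
Proof.
move=> hc sep cFx Fx; split=> // u Fu; apply/negPn/negP => /sep[V [cV Vu]].
apply; rewrite -cV; apply: (preclosure_mono _ _ _ hc.1 _ _ cFx) => a Fa.
exact: closed_down hc cV Vu (Fu a Fa).
Qed.

(** Suprema of [F] in a qoset are only unique up to equivalence, so the one in
[c F] need not be [x]; but [x] lies below it and [c F] is down-closed. *)
Lemma suprema_csup c F x : enriched c -> has_csup c F -> suprema F x -> c F x.
Proof.
move=> [_ hd] [s [Fs _] cFs] [_ minx].
by rewrite -hd; exists s => //; exact: minx.
Qed.

End UpPart.

Theorem theorem5p12 (d : Order.disp_t) (E : preorderType d)
    (c : set E -> set E) (hc : enriched c) :
  finitary_part (up_part c) = up_part (finitary_part c) /\
  ((forall x : E, finite_set (downset [set x])) \/ finitary c ->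
    [/\ finitary (up_part c),
        forall A : set E,
          up_part c A =
          \bigcup_(F in [set F | finite_set F /\ F `<=` A])
            (c F `&` upper_bounds F)
      & separates_points c ->
        forall A : set E,
          up_part c A =
          \bigcup_(F in [set F | [/\ finite_set F, F `<=` A & has_csup c F]])
            suprema F]).
Proof.
have hp := hc.1.
have swap : finitary_part (up_part c) = up_part (finitary_part c).
  by apply/funext => A; rewrite finitary_up_partE // up_finitary_partE.
split=> // /(up_part_finitary_part _ hp) upE.
have formula A : up_part c A =
    \bigcup_(F in [set F | finite_set F /\ F `<=` A]) (c F `&` upper_bounds F).
  by rewrite -upE up_finitary_partE.
split=> // [|sep A]; first by rewrite /finitary swap upE.
rewrite formula; apply/seteqP; split=> x [F].
  move=> [finF FA] [cFx Fx].
  have supx : suprema F x by exact: csup_suprema hc sep cFx Fx.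
  by exists F => //; split=> //; exists x.
move=> [finF FA csupF] supx; exists F => //.
by split; [exact: suprema_csup hc csupF supx|exact: supx.1].
Qed.
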